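(* Let $\mathcal{A}$ be the set of all Arndt compositions (of all weights $n\ge 0$), and for $\sigma\in\mathcal{A}$ let $|\sigma|$ be its weight and $\mathrm{parts}(\sigma)$ its number of parts. Then, as formal power series, $$A(x,y):=\sum_{\sigma\in\mathcal{A}}x^{|\sigma|}y^{\mathrm{parts}(\sigma)}=\frac{1 - x - x^2 + x^3 + x y - x^3 y}{1 - x - x^2 + x^3 - x^3 y^2}.$$
   Context: A composition of a nonnegative integer $n$ is a finite sequence $\sigma=(\sigma_1,\dots,\sigma_\ell)$ of positive integers with $\sigma_1+\cdots+\sigma_\ell=n$; $n=|\sigma|$ is its weight and $\ell$ its number of parts (the empty composition is the unique composition of $0$, with $0$ parts). An Arndt composition is a composition with $\sigma_{2i-1}>\sigma_{2i}$ for every positive integer $i$ with $2i\le \ell$ (if $\ell$ is odd, the last part is unconstrained). *)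

(* Defs.v *)
From HB Require Import structures.
From mathcomp Require Import all_boot all_order all_algebra.
From mathcomp Require Import boolp classical_sets cardinality fsbigop.

Set Implicit Arguments.
Unset Strict Implicit.
Unset Printing Implicit Defensive.

Import GRing.Theory.

Local Open Scope ring_scope.
Local Open Scope classical_set_scope.

(* R[[t]], with a series given by its sequence of coefficients; the nesting
   {fps {fps R}} is the ring of series in two variables. *)
Record fps (R : Type) := Fps { fps_coef : nat -> R }.

Notation "{ 'fps' R }" := (fps R) (at level 0, format "{ 'fps'  R }").

Lemma fpsP (R : Type) (a b : {fps R}) :
  (forall n, fps_coef a n = fps_coef b n) -> a = b.
Proof. by case: a b => [a] [b] /= ab; congr Fps; apply/funext. Qed.

HB.instance Definition _ (R : Type) := gen_eqMixin {fps R}.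
HB.instance Definition _ (R : Type) := gen_choiceMixin {fps R}.

Definition fps_zero (R : zmodType) : {fps R} := Fps (fun=> 0).
Definition fps_opp (R : zmodType) (a : {fps R}) := Fps (fun n => - fps_coef a n).
Definition fps_add (R : zmodType) (a b : {fps R}) :=
  Fps (fun n => fps_coef a n + fps_coef b n).

Lemma fps_addA (R : zmodType) : associative (@fps_add R).
Proof. by move=> a b c; apply: fpsP => n /=; rewrite addrA. Qed.
Lemma fps_addC (R : zmodType) : commutative (@fps_add R).
Proof. by move=> a b; apply: fpsP => n /=; rewrite addrC. Qed.
Lemma fps_add0 (R : zmodType) : left_id (@fps_zero R) (@fps_add R).
Proof. by move=> a; apply: fpsP => n /=; rewrite add0r. Qed.
Lemma fps_addN (R : zmodType) :
  left_inverse (@fps_zero R) (@fps_opp R) (@fps_add R).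
Proof. by move=> a; apply: fpsP => n /=; rewrite addNr. Qed.

HB.instance Definition _ (R : zmodType) := GRing.isZmodule.Build {fps R}
  (@fps_addA R) (@fps_addC R) (@fps_add0 R) (@fps_addN R).

Definition fpsC (R : zmodType) (c : R) : {fps R} :=
  Fps (fun n => if n == 0%N then c else 0).
Definition fpsX (R : nzRingType) : {fps R} := Fps (fun n => (n == 1%N)%:R).

Definition fps_mul (R : pzRingType) (a b : {fps R}) :=
  Fps (fun n => \sum_(i < n.+1) fps_coef a i * fps_coef b (n - i)).

Definition fps_trunc (R : nzRingType) (N : nat) (a : {fps R}) : {poly R} :=
  \poly_(i < N) fps_coef a i.

Lemma fps_coef_mul_trunc (R : nzRingType) (N : nat) (a b : {fps R}) n :
  (n < N)%N -> fps_coef (fps_mul a b) n = (fps_trunc N a * fps_trunc N b)`_n.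
Proof.
move=> nN; rewrite coefM /=; apply: eq_bigr => i _; rewrite !coef_poly.
by rewrite (leq_ltn_trans _ nN) ?leq_ord// (leq_ltn_trans (leq_subr _ _) nN).
Qed.

Lemma fps_mulA (R : comNzRingType) : associative (@fps_mul R).
Proof.
move=> a b c; apply: fpsP => n.
transitivity (fps_trunc n.+1 a * fps_trunc n.+1 b * fps_trunc n.+1 c)`_n.
  rewrite -mulrA coefM /=; apply: eq_bigr => i _; rewrite coef_poly ltn_ord.
  by rewrite -(@fps_coef_mul_trunc _ n.+1) // ltnS leq_subr.
rewrite coefM; apply: eq_bigr => i _.
by rewrite coef_poly ltnS leq_subr -fps_coef_mul_trunc.
Qed.

Lemma fps_mulC (R : comNzRingType) : commutative (@fps_mul R).
Proof.
by move=> a b; apply: fpsP => n; rewrite !(@fps_coef_mul_trunc _ n.+1)// mulrC.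
Qed.

Lemma fps_mul1 (R : comNzRingType) : left_id (@fpsC R 1) (@fps_mul R).
Proof.
move=> a; apply: fpsP => n /=; rewrite big_ord_recl /= mul1r subn0.
by rewrite big1 ?addr0 // => i _; rewrite mul0r.
Qed.

Lemma fps_mulDl (R : comNzRingType) : left_distributive (@fps_mul R) +%R.
Proof.
move=> a b c; apply: fpsP => n /=; rewrite -big_split /=.
by apply: eq_bigr => i _; rewrite mulrDl.
Qed.

Lemma fps_1neq0 (R : comNzRingType) : fpsC 1 != 0 :> {fps R}.
Proof.
by apply/eqP => /(congr1 (fun a => fps_coef a 0)) /= /eqP; rewrite oner_eq0.
Qed.

HB.instance Definition _ (R : comNzRingType) :=
  GRing.Zmodule_isComNzRing.Build {fps R} (@fps_mulA R) (@fps_mulC R)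
    (@fps_mul1 R) (@fps_mulDl R) (@fps_1neq0 R).

Definition fps_unit (R : comNzRingType) : {pred {fps R}} :=
  fun a => `[< exists b : {fps R}, b * a = 1 >].

Definition fps_inv (R : comNzRingType) (a : {fps R}) : {fps R} :=
  if pselect (exists b : {fps R}, b * a = 1) is left ex then projT1 (cid ex)
  else a.

Lemma fps_mulVx (R : comNzRingType) :
  {in @fps_unit R, left_inverse 1 (@fps_inv R) *%R}.
Proof.
move=> a /asboolP ua; rewrite /fps_inv; case: pselect => // ex.
by case: (cid ex).
Qed.

Lemma fps_unitPl (R : comNzRingType) (a b : {fps R}) :
  b * a = 1 -> fps_unit a.
Proof. by move=> ba; apply/asboolP; exists b. Qed.

Lemma fps_inv_out (R : comNzRingType) :
  {in [predC @fps_unit R], @fps_inv R =1 id}.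
Proof.
move=> a /negP na; rewrite /fps_inv; case: pselect => // ex.
by case: na; apply/asboolP.
Qed.

HB.instance Definition _ (R : comNzRingType) :=
  GRing.ComNzRing_hasMulInverse.Build {fps R}
    (@fps_mulVx R) (@fps_unitPl R) (@fps_inv_out R).

Fixpoint fps_inv_seq (R : comUnitRingType) (a : {fps R}) (n : nat) : seq R :=
  if n is m.+1 then
    let s := fps_inv_seq a m in
    rcons s ((fps_coef a 0)^-1 *
      ((m == 0%N)%:R - \sum_(i < m) s`_i * fps_coef a (m - i)))
  else [::].

Lemma unit_fps (R : comUnitRingType) (a : {fps R}) :
  fps_coef a 0 \is a GRing.unit -> a \is a GRing.unit.
Proof.
move=> ua; have sz n : size (fps_inv_seq a n) = n.
  by elim: n => //= n IH; rewrite size_rcons IH.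
have stab n i : (i < n)%N ->
    (fps_inv_seq a n)`_i = (fps_inv_seq a i.+1)`_i.
  elim: n => // n IH; rewrite ltnS leq_eqVlt => /orP[/eqP -> //|lt_in].
  by rewrite -IH //= nth_rcons sz lt_in.
have [b bE] : exists b : nat -> R, forall n, b n = (fps_coef a 0)^-1 *
    ((n == 0%N)%:R - \sum_(i < n) b i * fps_coef a (n - i)).
  exists (fun i => (fps_inv_seq a i.+1)`_i) => n.
  rewrite [LHS]/= nth_rcons sz ltnn eqxx; congr (_ * (_ - _)).
  by apply: eq_bigr => i _; rewrite (stab n).
apply: (@fps_unitPl _ _ (Fps b)); apply: fpsP => n /=.
rewrite big_ord_recr /= subnn [b n]bE mulrAC mulVr // mul1r addrC subrK.
by case: eqP.
Qed.

Lemma fps_coef_mulCl (R : comNzRingType) (c : R) (a : {fps R}) n :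
  fps_coef (fpsC c * a) n = c * fps_coef a n.
Proof.
rewrite /= big_ord_recl /= subn0 big1 ?addr0 // => i _.
by rewrite mul0r.
Qed.

Lemma fpsC_exp (R : comNzRingType) (c : R) m : fpsC c ^+ m = fpsC (c ^+ m).
Proof.
elim: m => [//|m IH]; rewrite exprS IH; apply: fpsP => n.
by rewrite fps_coef_mulCl /= exprS; case: eqP => //; rewrite mulr0.
Qed.

Lemma fps_coefX (R : comNzRingType) m n :
  fps_coef ((fpsX R) ^+ m) n = (n == m)%:R.
Proof.
elim: m n => [|m IH] n; first by rewrite expr0 /=; case: eqP.
rewrite exprS /=; case: n => [|n].
  by rewrite big_ord_recl big_ord0 /= mul0r addr0.
rewrite !big_ord_recl /= mul0r add0r mul1r subSS subn0 IH eqSS big1 ?addr0 //.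
by move=> i _; rewrite mul0r.
Qed.

(* Z[[x]][[y]]: the coefficient of x^n y^k in a is
   fps_coef (fps_coef a k) n. *)
Definition xvar : {fps {fps int}} := fpsC (fpsX int).
Definition yvar : {fps {fps int}} := fpsX {fps int}.

(* The sum of a family of bivariate series, coefficient by coefficient.  The
   finitely supported sum defaults to 0 at a coefficient to which infinitely
   many members contribute, so the meaning is the intended one only for locally
   finite families; arndt_locally_finite is this condition for the family of
   interest. *)
Definition fps2_sum (R : zmodType) (T : choiceType) (D : set T)
    (F : T -> {fps {fps R}}) : {fps {fps R}} :=
  Fps (fun k => Fps (fun n =>
    \sum_(s \in D) fps_coef (fps_coef (F s) k) n)).

Definition composition (s : seq nat) : Prop := all (fun m => 0 < m)%N s.

Definition weight (s : seq nat) : nat := sumn s.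

(* Parts are numbered from 1. *)
Definition part (s : seq nat) (j : nat) : nat := nth 0%N s j.-1.

Definition arndt (s : seq nat) : Prop :=
  composition s /\
  forall i : nat, (0 < i)%N -> (2 * i <= size s)%N ->
    (part s (2 * i - 1) > part s (2 * i))%N.

Lemma coef_monomial m l n k :
  fps_coef (fps_coef (xvar ^+ m * yvar ^+ l) k) n = ((n == m) && (k == l))%:R.
Proof.
rewrite /xvar /yvar fpsC_exp fps_coef_mulCl fps_coefX.
case: (k == l); last by rewrite mulr0 andbF.
by rewrite mulr1 fps_coefX andbT.
Qed.

Lemma arndt_locally_finite k n :
  finite_set [set s | arndt s /\
    fps_coef (fps_coef (xvar ^+ weight s * yvar ^+ size s) k) n != 0].
Proof.
pose f (t : k.-tuple 'I_n.+1) := [seq val i | i <- t].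
apply: (@sub_finite_set _ _ (f @` setT)); last exact: finite_image.
move=> s [_]; rewrite coef_monomial.
case: (n =P weight s) => //= ns; case: (k =P size s) => //= ks _.
have szs : size [seq inord i : 'I_n.+1 | i <- s] == k by rewrite size_map ks.
exists (Tuple szs) => //; rewrite /f /= -map_comp -[RHS]map_id.
apply/eq_in_map => i /= si; rewrite inordK // ltnS ns /weight.
elim: s si {ns ks szs} => //= a s IH; rewrite inE => /orP[/eqP->|/IH le_i].
  exact: leq_addr.
exact: leq_trans le_i (leq_addl _ _).
Qed.

Lemma arndt_denominator_unit :
  1 - xvar - xvar ^+ 2 + xvar ^+ 3 - xvar ^+ 3 * yvar ^+ 2 \is a GRing.unit.
Proof.
have c0 m : (0 < m)%N -> fps_coef (fps_coef (xvar ^+ m) 0) 0 = 0.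
  by rewrite -[xvar ^+ m]mulr1 -(expr0 yvar) coef_monomial; case: m.
do 2!apply: unit_fps; rewrite -[X in 1 - X](expr1 xvar).
have cD (a b : {fps {fps int}}) : fps_coef (fps_coef (a + b) 0) 0 =
  fps_coef (fps_coef a 0) 0 + fps_coef (fps_coef b 0) 0 by [].
have cN (a : {fps {fps int}}) : fps_coef (fps_coef (- a) 0) 0 =
  - fps_coef (fps_coef a 0) 0 by [].
by rewrite !cD !cN !c0 // coef_monomial.
Qed.

(* Main.v *)
(* Arndt compositions form a disjoint union of the empty composition, the set S of
   one-part compositions, and the set P of those with at least two parts.
   Incrementing the first part maps S onto S minus {(1)}, and maps the set P1 of
   elements of P with second part 1 onto the elements of P1 with first part > 2;
   the remaining elements of P1 are 2, 1 followed by any Arndt composition.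
   Incrementing the first two parts maps P onto P minus P1.  Hence
     A = 1 + S + P, S = xy + xS, P = P1 + x^2 P, P1 = x^3 y^2 A + x P1,
   and eliminating S, P, P1 gives the quotient. *)
Require Import Defs.
From mathcomp Require Import all_boot all_order all_algebra.
From mathcomp Require Import boolp classical_sets cardinality fsbigop.
From mathcomp Require Import zify ring.

Import GRing.Theory.

Local Open Scope ring_scope.
Local Open Scope classical_set_scope.

Lemma fps_coef_mulXn (R : comNzRingType) (m n : nat) (a : {fps R}) :
  fps_coef (fpsX R ^+ m * a) n = if (m <= n)%N then fps_coef a (n - m) else 0.
Proof.
rewrite /=; case: ifP => mn; last first.
  rewrite big1// => i _; rewrite fps_coefX.
  by case: eqP => [im|]; [have := ltn_ord i; lia | rewrite mul0r].
rewrite (bigD1 (inord m)) //= fps_coefX inordK // eqxx mul1r big1 ?addr0//.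
move=> i; rewrite -val_eqE /= inordK // fps_coefX => /negPf->.
by rewrite mul0r.
Qed.

Lemma coef_monomial_mul (a : {fps {fps int}}) m l n k :
  fps_coef (fps_coef (xvar ^+ m * yvar ^+ l * a) k) n =
  if (m <= n)%N && (l <= k)%N then fps_coef (fps_coef a (k - l)) (n - m) else 0.
Proof.
rewrite /xvar /yvar fpsC_exp -mulrA fps_coef_mulCl !fps_coef_mulXn.
by case: (l <= k)%N; rewrite ?andbT ?andbF //; case: ifP.
Qed.

(** A monomial factor only shifts coefficient indices: at each coefficient either all terms vanish
    or both sides are the same sum, default value 0 included. *)
Lemma fps2_sum_monomial_mul (T : choiceType) (D : set T)
    (F : T -> {fps {fps int}}) m l :
  fps2_sum D (fun s => xvar ^+ m * yvar ^+ l * F s) =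
  xvar ^+ m * yvar ^+ l * fps2_sum D F.
Proof.
apply: fpsP => k; apply: fpsP => n; rewrite coef_monomial_mul /=.
under eq_fsbigr do rewrite coef_monomial_mul.
by case: ifP => // _; rewrite fsbig1.
Qed.

Definition gf (D : set (seq nat)) : {fps {fps int}} :=
  fps2_sum D (fun s => xvar ^+ weight s * yvar ^+ size s).

Lemma gf_set1 (s : seq nat) : gf [set s] = xvar ^+ weight s * yvar ^+ size s.
Proof. by apply: fpsP => k; apply: fpsP => n /=; rewrite fsbig_set1. Qed.

(** Inclusion in [arndt] makes the support at each coefficient finite, so the default value 0 of an
    infinite sum cannot break additivity. *)
Lemma gfU (D E : set (seq nat)) :
  D `<=` arndt -> E `<=` arndt -> D `&` E `<=` set0 ->
  gf (D `|` E) = gf D + gf E.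
Proof.
move=> DA EA DE; apply: fpsP => k; apply: fpsP => n /=.
rewrite fsbig_supp setIUl fsbigU0 -?fsbig_supp //.
- by apply: sub_finite_set (arndt_locally_finite k n) => s [/DA sA /eqP].
- by apply: sub_finite_set (arndt_locally_finite k n) => s [/EA sA /eqP].
- by move=> s [[Ds _] [Es _]]; apply: DE.
Qed.

Lemma gf_image (D : set (seq nat)) (f : seq nat -> seq nat) m l :
  injective f ->
  (forall s, D s -> weight (f s) = (m + weight s)%N /\ size (f s) = (l + size s)%N) ->
  gf (f @` D) = xvar ^+ m * yvar ^+ l * gf D.
Proof.
move=> fI fD; rewrite -fps2_sum_monomial_mul.
congr Fps; apply/funext => k; congr Fps; apply/funext => n.
rewrite fsbig_image//; last by move=> ? ? _ _; exact: fI.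
apply: eq_fsbigr => s /set_mem /fD [-> ->].
by congr (fps_coef (fps_coef _ _) _); rewrite !exprD; ring.
Qed.

Lemma arndt_nil : arndt [::].
Proof. by split=> // i /=; lia. Qed.

Lemma arndt1 a : arndt [:: a] <-> (0 < a)%N.
Proof.
split=> [[]|a0]; first by rewrite /composition /= andbT.
by split=> [|i /=]; [rewrite /composition /= a0 | lia].
Qed.

(** Dropping the first pair lowers the pair index i by one and keeps the parity of positions; the
    case i = 1 is [b < a]. *)
Lemma arndt_cons2 a b s : arndt [:: a, b & s] <-> (0 < b < a)%N /\ arndt s.
Proof.
rewrite /arndt /composition /=; split=> [[/and3P[a0 b0 s0] ab]|[/andP[b0 ab] [s0 sP]]].
  have /= := ab 1%N isT isT; rewrite /part /= b0 => ->; split=> //; split=> // i i0 si.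
  have := ab i.+1 isT; rewrite /part.
  have -> : (2 * i.+1).-1 = (2 * i).-1.+2 by lia.
  have -> : (2 * i.+1 - 1).-1 = (2 * i - 1).-1.+2 by lia.
  by apply; lia.
split=> [|[|[|i]] // _ si]; first by rewrite b0 s0 (leq_trans b0 (ltnW ab)).
have := sP i.+1 isT; rewrite /part.
have -> : (2 * i.+2).-1 = (2 * i.+1).-1.+2 by lia.
have -> : (2 * i.+2 - 1).-1 = (2 * i.+1 - 1).-1.+2 by lia.
by apply; lia.
Qed.

(** Lists that are too short stay fixed, so that [incr1] and [incr2] are injective on all lists, as
    [gf_image] asks. *)
Definition incr1 (s : seq nat) : seq nat := if s is a :: t then a.+1 :: t else s.

Definition incr2 (s : seq nat) : seq nat :=
  if s is [:: a, b & t] then [:: a.+1, b.+1 & t] else s.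

Lemma incr1_inj : injective incr1.
Proof. by case=> [|a s] [|b t] //= [-> ->]. Qed.

Lemma incr2_inj : injective incr2.
Proof.
by case=> [|a [|b s]] [|c [|d t]] //= [] // *; subst.
Qed.

Definition arndt_one : set (seq nat) := [set s | arndt s /\ size s = 1%N].
Definition arndt_many : set (seq nat) := [set s | arndt s /\ (2 <= size s)%N].
(** Since [part] is 0 past the end, a second part equal to 1 forces at least two parts. *)
Definition arndt_many1 : set (seq nat) := [set s | arndt s /\ part s 2 = 1%N].

Lemma gf_arndt : gf arndt = 1 + gf arndt_one + gf arndt_many.
Proof.
have -> : arndt = [set [::]] `|` arndt_one `|` arndt_many :> set (seq nat).
  apply/seteqP; split=> [[|a [|b s]] sA|s [[->|[]//]|[]//]]; last exact: arndt_nil.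
  - by left; left.
  - by left; right.
  - by right.
rewrite !gfU ?gf_set1 ?expr0 ?mulr1 //.
- by move=> s ->; exact: arndt_nil.
- by move=> s [].
- by move=> s [-> []].
- by move=> s [->|[]//]; exact: arndt_nil.
- by move=> s [].
- by move=> s [[->|[_ s1]] [_]] //; rewrite s1.
Qed.

Lemma gf_arndt_one : gf arndt_one = xvar * yvar + xvar * gf arndt_one.
Proof.
have e : arndt_one = [set [:: 1%N]] `|` incr1 @` arndt_one.
  apply/seteqP; split=> [[|a [|b s]] [] //|s [->|[[|a [|b t]] [] // _ _ <-]]].
  - move=> /arndt1; case: a => [|[|a]]// _ _; first by left.
    by right; exists [:: a.+1] => //; split=> //; apply/arndt1.
  - by split=> //; apply/arndt1.
  - by split=> //; apply/arndt1.
rewrite {1}e gfU.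
- by rewrite gf_set1 (@gf_image _ _ 1 0 incr1_inj) ?expr1 ?expr0 ?mulr1 // => -[|a s] [].
- by move=> s ->; apply/arndt1.
- by move=> s se; have [] : arndt_one s by rewrite e; right.
(* A preimage of (1) would be (0), which has a zero part. *)
- by move=> s [-> [[|a [|b t]] [] // /arndt1 a0 _ [a1]]]; lia.
Qed.

Lemma gf_arndt_many :
  gf arndt_many = gf arndt_many1 + xvar ^+ 2 * gf arndt_many.
Proof.
have e : arndt_many = arndt_many1 `|` incr2 @` arndt_many.
  apply/seteqP; split=> [[|a [|b s]] [] //|s [[sA s2]|[[|a [|b t]] [] // + _ <-]]].
  - move=> /arndt_cons2 [ba sA] _.
    (* If the second part is at least 2, lowering both parts by 1 keeps their difference and leaves
       them positive. *)
    case: a b ba => [|a] [|[|b]] // ba.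
      by left; split=> //; apply/arndt_cons2.
    right; exists [:: a, b.+1 & s] => //; split=> //.
    by apply/arndt_cons2; split=> //; lia.
  - by split=> //; case: s s2 {sA} => [|a [|b s]].
  - by move=> /arndt_cons2 [ba tA]; split=> //; apply/arndt_cons2; split=> //; lia.
rewrite {1}e gfU.
- rewrite (@gf_image _ _ 2 0 incr2_inj) ?expr0 ?mulr1 // => -[|a [|b s]] [] //= _ _.
  by rewrite /weight /=; split=> //; lia.
- by move=> s [].
- by move=> s se; have [] : arndt_many s by rewrite e; right.
- move=> s [[sA s2] [[|a [|b t]] [] // /arndt_cons2 [ba _] _ se]].
  (* A second part raised by [incr2] is at least 2. *)
  by move: s2; rewrite -se /part /=; lia.
Qed.

Lemma gf_arndt_many1 :
  gf arndt_many1 = xvar ^+ 3 * yvar ^+ 2 * gf arndt + xvar * gf arndt_many1.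
Proof.
have e : arndt_many1 = (fun s => [:: 2, 1 & s]%N) @` arndt `|` incr1 @` arndt_many1.
  apply/seteqP; split=> [[|a [|b s]] [] //|s [[t tA <-]|[[|a [|b t]] [] // + + <-]]].
  - rewrite /part /= => /arndt_cons2 [ba sA] b1; subst b.
    (* The first part exceeds 1: the value 2 gives the prefix 2, 1, and a larger value can be
       lowered by 1. *)
    case: a ba => [|[|[|a]]] // _; first by left; exists s.
    by right; exists [:: a.+2, 1%N & s] => //; split=> //; apply/arndt_cons2.
  - by split=> //; apply/arndt_cons2.
  - move=> /arndt_cons2 [ba tA] b1; split=> //.
    by apply/arndt_cons2; split=> //; lia.
rewrite {1}e gfU.
- rewrite (@gf_image _ _ 3 2) //; last by move=> s t [].
  by rewrite (@gf_image _ _ 1 0 incr1_inj) ?expr0 ?expr1 ?mulr1 // => -[|a s] [].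
- by move=> s [t tA <-]; apply/arndt_cons2.
- by move=> s se; have [] : arndt_many1 s by rewrite e; right.
- move=> s [[u _ <-] [[|a [|b t]] [] // /arndt_cons2 [ba _] b1 [a1 _ _]]].
  (* A first part 2 after [incr1] was 1 before, which does not exceed the second part 1. *)
  by move: b1; rewrite /part /=; lia.
Qed.

Theorem theorem2p1 :
  fps2_sum [set s : seq nat | arndt s]
    (fun s => xvar ^+ weight s * yvar ^+ size s)
  = (1 - xvar - xvar ^+ 2 + xvar ^+ 3 + xvar * yvar - xvar ^+ 3 * yvar)
    / (1 - xvar - xvar ^+ 2 + xvar ^+ 3 - xvar ^+ 3 * yvar ^+ 2).
Proof.
apply: (mulIr arndt_denominator_unit); rewrite divrK ?arndt_denominator_unit //.
rewrite -/(gf arndt).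
move: gf_arndt gf_arndt_one gf_arndt_many gf_arndt_many1.
move: (gf arndt) (gf arndt_one) (gf arndt_many) (gf arndt_many1) => A S P P1.
move: xvar yvar => x y eA eS eP eP1.
have sub0 (u v : {fps {fps int}}) : u = v -> u - v = 0 by move=> ->; rewrite subrr.
apply/eqP; rewrite -subr_eq0; apply/eqP.
(* The multipliers clear the denominators 1 - x and 1 - x^2 that arise on solving for S, P and P1,
   so these three cancel. *)
transitivity ((1 - x) * (1 - x ^+ 2) * (A - (1 + S + P))
  + (1 - x ^+ 2) * (S - (x * y + x * S))
  + (1 - x) * (P - (P1 + x ^+ 2 * P))
  + (P1 - (x ^+ 3 * y ^+ 2 * A + x * P1))); first by ring.
by rewrite (sub0 _ _ eA) (sub0 _ _ eS) (sub0 _ _ eP) (sub0 _ _ eP1) !mulr0 !addr0.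
Qed.
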